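(* Let $p\ge 5$ be a prime with $p\equiv 3\pmod 4$ and let $m,\alpha,\beta\ge 1$ be integers with $2\nmid\alpha$. Then for all integers $n,k\ge 0$ with $p\nmid n$, $$\bar a_{2^m\alpha}\left(4p^{2k+1}n+p^{2k+2}\right)\equiv 0\pmod{2^{m+2}},$$ $$\bar a_{2\beta+1}\left(4p^{2k+1}n+p^{2k+2}\right)\equiv 0\pmod 4.$$
   Context: For integers $\ell\ge1$ write $f_\ell=\prod_{j\ge 1}(1-q^{\ell j})$. For a positive integer $s$, $\bar a_s(n)$ denotes the number of partitions of $n$ in which each odd part occurs in one of $s$ colors and the first occurrence of each part (parts of the same size but different colors being distinct) may be overlined. Equivalently, $$\sum_{n\ge0}\bar a_s(n)q^n=\frac{f_2^{3s-2}}{f_1^{2s}f_4^{s-1}}.$$ *)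

(* Defs.v *)
From mathcomp Require Import all_boot.

Set Implicit Arguments.
Unset Strict Implicit.
Unset Printing Implicit Defensive.

(* The pair (i, c) : 'I_n * 'I_s stands for a part of size i + 1 (so sizes run
   over 1, ..., n) in colour c. Odd parts may take any of the s colours; even
   parts are uncoloured, which is encoded by allowing them only colour 0. *)
Definition part_size (n s : nat) (x : 'I_n * 'I_s) : nat := x.1.+1.

Definition admissible (n s : nat) (x : 'I_n * 'I_s) : bool :=
  odd (part_size x) || (x.2 == 0 :> nat).

(* A partition of n is given by the multiplicities mu of its coloured parts.
   Since only the first occurrence of each coloured part may be overlined, the
   overlining amounts to a set of coloured parts that do occur. Bounding
   both the sizes and the multiplicities by n loses nothing, as each part is at
   least 1. *)
Definition is_colored_overpartition (s n : nat)
    (mu : {ffun 'I_n * 'I_s -> 'I_n.+1}) (overlined : {set 'I_n * 'I_s}) : bool :=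
  [&& [forall x, (0 < mu x) ==> admissible x],
      \sum_x mu x * part_size x == n
    & overlined \subset [set x | 0 < mu x]].

Definition colored_overpartitions (s n : nat) :
    {set {ffun 'I_n * 'I_s -> 'I_n.+1} * {set 'I_n * 'I_s}} :=
  [set P | is_colored_overpartition P.1 P.2].

Definition abar (s n : nat) : nat := #|colored_overpartitions s n|.

(* Main.v *)
(** Expanding over multiplicities, [abar s n] is the coefficient of [X^n] in
    [E * O ^ s], where [E] and [O] are the products of [1 + 2 (X^i + X^2i + ...)]
    over even and odd [i] respectively. Write [O = 1 + 2 x]. The factor [E]
    is an even function of [X] and is 1 modulo 2, so for odd [n] we get
    [abar s n = 2 s x_n] modulo 4; and as
    [O ^ (2^m a) = 1 + 2^(m+1) (x + x^2)] modulo [2^(m+2)] for odd [a], where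
    [x^2] is even modulo 2, [abar (2^m a) n = 2^(m+1) x_n] modulo [2^(m+2)].
    Modulo 2, [x_n] is the number of divisors of [n]. It is even because
    [n = p^(2k+1) (4n' + p)] has odd [p]-adic valuation, hence is not a square. *)

Require Import Defs.
From mathcomp Require Import all_boot all_algebra ring.

Set Implicit Arguments.
Unset Strict Implicit.
Unset Printing Implicit Defensive.

Import GRing.Theory.
Local Open Scope ring_scope.

(** * Expansions modulo powers of 2 *)

Lemma expr1D_linear (R : comPzRingType) (u : R) (a : nat) :
  exists z, (1 + u) ^+ a = 1 + a%:R * u + u ^+ 2 * z.
Proof.
elim: a => [|a [z IHa]]; first by exists 0; rewrite expr0; ring.
exists (a%:R + z * (1 + u)); rewrite exprSr IHa; ring.
Qed.

Lemma prod_1D2_linear (R : comPzRingType) (I : finType) (P : pred I) (g : I -> R) :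
  exists z, \prod_(i | P i) (1 + 2 * g i) = 1 + 2 * \sum_(i | P i) g i + 4 * z.
Proof.
apply: (big_ind2 (fun a b => exists z, a = 1 + 2 * b + 4 * z)).
- by exists 0; ring.
- move=> _ b _ b' [z ->] [z' ->].
  by exists (z + z' + b * b' + 2 * b * z' + 2 * b' * z + 4 * z * z'); ring.
- by move=> i _; exists 0; ring.
Qed.

(** Since [(1 + 2 * x) ^+ 2 = 1 + 4 * (x + x ^+ 2)], the odd exponent [a] changes the linear term
    only by an even multiple. Each further squaring doubles the linear term, and the new square
    carries [2 ^ (2m + 4)], a multiple of [2 ^ (m + 4)]. *)
Lemma expr_1D2_pow2 (R : comPzRingType) (x : R) (m a : nat) : odd a ->
  exists z, (1 + 2 * x) ^+ (2 ^ m.+1 * a) =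
    1 + 2 ^+ m.+2 * (x + x ^+ 2) + 2 ^+ m.+3 * z.
Proof.
move=> a_odd; elim: m => [|m [z IHm]].
  have [z] := expr1D_linear (4 * (x + x ^+ 2)) a.
  have -> : a%:R = 1 + 2 * a./2%:R :> R.
    by rewrite -natrM mul2n -[1]/(1%:R) -natrD -{1}(odd_double_half a) a_odd.
  rewrite expn1 exprM.
  have -> : (1 + 2 * x) ^+ 2 = 1 + 4 * (x + x ^+ 2) by ring.
  move=> ->; exists (a./2%:R * (x + x ^+ 2) + 2 * (x + x ^+ 2) ^+ 2 * z).
  by rewrite !exprS expr0 /=; ring.
rewrite expnSr mulnAC exprM IHm.
set c : R := 2 ^+ m.
exists (z + c * (x + x ^+ 2 + 2 * z) ^+ 2).
by rewrite !(exprS 2) -/c; ring.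
Qed.

Lemma mod4_expansion (R : comPzRingType) (e x : R) (s : nat) :
  exists w, (1 + 2 * e) * (1 + 2 * x) ^+ s =
    1 + 2 * e + 2 ^+ 1 * (s%:R * x) + 2 ^+ 2 * w.
Proof.
have [z ->] := expr1D_linear (2 * x) s.
by exists (s%:R * x * e + (1 + 2 * e) * x ^+ 2 * z); ring.
Qed.

Lemma pow2_expansion (R : comPzRingType) (e x : R) (m a : nat) : odd a ->
  exists w, (1 + 2 * e) * (1 + 2 * x) ^+ (2 ^ m.+1 * a) =
    1 + 2 * e + 2 ^+ m.+2 * (x + x ^+ 2) + 2 ^+ m.+3 * w.
Proof.
move=> a_odd; have [z ->] := expr_1D2_pow2 x m a_odd.
exists (e * (x + x ^+ 2) + (1 + 2 * e) * z).
by rewrite !(exprS 2); move: (2 ^+ m) => c; ring.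
Qed.

(** * Coefficients at odd exponents and a parity count *)

Lemma coef_pow2M (R : nzRingType) (k n : nat) (q : {poly R}) :
  (2 ^+ k * q)`_n = 2 ^+ k * q`_n.
Proof. by rewrite -!natrX !mulr_natl coefMn. Qed.

Lemma coef_odd_comp_X2 (R : nzRingType) (q : {poly R}) (n : nat) :
  odd n -> (q \Po 'X^2)`_n = 0.
Proof. by move=> n_odd; rewrite coef_comp_poly_Xn // dvdn2 n_odd. Qed.

Lemma coef_odd_sqr (R : comNzRingType) (q : {poly R}) (n : nat) :
  odd n -> exists c, (q ^+ 2)`_n = 2 * c.
Proof.
move=> n_odd; set a := even_poly q; set b := odd_poly q.
exists (((a \Po 'X^2) * (b \Po 'X^2) * 'X)`_n).
(* With q = a(X^2) + X b(X^2), the squares of both summands are polynomials in X^2; only the cross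
   term, which is doubled, reaches odd exponents. *)
have -> : q ^+ 2 = ((a ^+ 2 + b ^+ 2 * 'X) \Po 'X^2)
    + ((a \Po 'X^2) * (b \Po 'X^2) * 'X) *+ 2.
  rewrite -[in LHS](poly_even_odd q) -/a -/b.
  rewrite comp_polyD !(expr2 a, expr2 b, comp_polyM) comp_polyX.
  by ring.
by rewrite coefD coef_odd_comp_X2 // add0r coefMn mulr_natl.
Qed.

(** Swapping [i] and [j] pairs the terms off the diagonal, so the sum is twice its part with
    [i < j]. *)
Lemma sum_sym_even (n : nat) (f : 'I_n -> 'I_n -> nat) :
    (forall i j, f i j = f j i) -> (forall i, f i i = 0%N) ->
  (2 %| \sum_i \sum_j f i j)%N.
Proof.
move=> fC f0.
have -> : (\sum_i \sum_j f i j =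
    \sum_(i < n) \sum_(j < n | i < j) f i j +
    \sum_(i < n) \sum_(j < n | j < i) f i j)%N.
  rewrite -big_split; apply: eq_bigr => i _ /=.
  rewrite (bigID (fun j : 'I_n => i < j)%N) /=; congr (_ + _)%N.
  rewrite (bigD1 i) ?ltnn //= f0 add0n.
  by apply: eq_bigl => j; rewrite -leqNgt andbC -val_eqE /= -ltn_neqAle.
have -> : (\sum_(i < n) \sum_(j < n | j < i) f i j =
    \sum_(i < n) \sum_(j < n | i < j) f i j)%N.
  rewrite (exchange_big_dep xpredT) //=.
  by apply: eq_bigr => i _; apply: eq_bigr => j _; apply: fC.
by rewrite addnn -muln2 dvdn_mull.
Qed.

(** * The generating polynomial of [abar] *)

Section GeneratingPolynomial.

Variable n : nat.

(** The truncation at [n] matches the bound on multiplicities in [abar], so polynomials replace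
    power series. *)
Definition multiples_poly (d : nat) : {poly int} := \sum_(j < n) 'X^(j.+1 * d).

Definition even_parts_poly : {poly int} :=
  \prod_(i < n | ~~ odd i.+1) (1 + 2 * multiples_poly i.+1).

Definition odd_parts_poly : {poly int} :=
  \prod_(i < n | odd i.+1) (1 + 2 * multiples_poly i.+1).

Lemma card_overlinings (s : nat) (mu : {ffun 'I_n * 'I_s -> 'I_n.+1}) :
  #|[set ov | is_colored_overpartition mu ov]| =
  if [forall x, (0 < mu x)%N ==> admissible x]
     && (\sum_x mu x * part_size x == n)%N
  then (2 ^ #|[set x | 0 < mu x]%N|)%N else 0%N.
Proof.
case: ifP => mu_ok.
  rewrite -card_powerset; apply: eq_card => ov.
  by rewrite !inE /is_colored_overpartition andbA mu_ok.
by apply: eq_card0 => ov; rewrite !inE /is_colored_overpartition andbA mu_ok.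
Qed.

(** The weight of the part [x] taken [j] times: the factor 2 records whether its first occurrence is
    overlined, and inadmissible parts get weight 0. *)
Definition part_term (s : nat) (x : 'I_n * 'I_s) (j : 'I_n.+1) : {poly int} :=
  if j == 0 :> nat then 1
  else if admissible x then 2 * 'X^(j * part_size x) else 0.

Lemma prod_part_term (s : nat) (mu : {ffun 'I_n * 'I_s -> 'I_n.+1}) :
  \prod_x part_term x (mu x) =
  if [forall x, (0 < mu x)%N ==> admissible x]
  then 2 ^+ #|[set x | 0 < mu x]%N| * 'X^(\sum_x mu x * part_size x) else 0.
Proof.
case: ifP => [/forallP mu_ok | /forallPn /= [x]]; last first.
  rewrite negb_imply lt0n => /andP [mux adm].
  by rewrite (bigD1 x) //= /part_term (negbTE mux) (negbTE adm) mul0r.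
transitivity (\prod_x ((if (0 < mu x)%N then 2 else 1) * 'X^(mu x * part_size x)
    : {poly int})).
  apply: eq_bigr => x _; have := mu_ok x; rewrite /part_term lt0n.
  by case: eqP => [-> _ | _ /= ->]; rewrite ?mul0n ?mulr1.
rewrite big_split -big_mkcond /= prodr_const prodrXr.
by congr (_ ^+ _ * _); apply: eq_card => x; rewrite inE.
Qed.

Lemma sum_part_term (s : nat) (x : 'I_n * 'I_s) :
  \sum_j part_term x j =
  if admissible x then 1 + 2 * multiples_poly (part_size x) else 1.
Proof.
rewrite big_ord_recl /part_term /=; case: ifP => _.
  by congr (_ + _); rewrite mulr_sumr.
by rewrite big1 ?addr0.
Qed.

(** An odd size contributes one equal factor per colour, an even size only the factor of colour 0.
    Writing [s.+1] ensures that colour 0 exists. *)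
Lemma prod_sum_part_term (s : nat) :
  \prod_(x : 'I_n * 'I_s.+1) \sum_j part_term x j =
  even_parts_poly * odd_parts_poly ^+ s.+1.
Proof.
under eq_bigr => x _ do rewrite sum_part_term.
rewrite -(pair_bigA _ (fun i c => if admissible (i, c)
  then 1 + 2 * multiples_poly (part_size (i, c)) else 1)) /=.
rewrite /even_parts_poly /odd_parts_poly -prodrXl mulrC.
rewrite (bigID (fun i : 'I_n => odd i.+1)) /=; congr (_ * _).
  apply: eq_bigr => i i_odd; rewrite -[in RHS](card_ord s.+1) -prodr_const.
  by apply: eq_bigr => c _; rewrite /admissible /part_size /= i_odd.
apply: eq_bigr => i /negbTE i_even.
rewrite big_ord_recl big1 /admissible /part_size /= ?i_even ?mulr1 //.
Qed.

Lemma abar_coef (s : nat) :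
  (abar s.+1 n)%:R = (even_parts_poly * odd_parts_poly ^+ s.+1)`_n.
Proof.
rewrite -prod_sum_part_term bigA_distr_bigA coef_sum /=.
transitivity (\sum_(mu : {ffun 'I_n * 'I_s.+1 -> 'I_n.+1})
    #|[set ov | is_colored_overpartition mu ov]|%:R : int).
  (* Group the overpartitions by their multiplicity function. *)
  rewrite -natr_sum /abar; congr (_%:R).
  rewrite -sum1_card (partition_big (fun P => P.1) xpredT) //=.
  apply: eq_bigr => mu _; rewrite sum1_card.
  have inj_mu : injective (@pair _ {set 'I_n * 'I_s.+1} mu) by move=> ? ? [].
  rewrite -(card_imset _ inj_mu).
  apply: eq_card => -[mu' ov]; rewrite unfold_in /= inE.
  apply/andP/imsetP => /= [[ok /eqP <-] | [ov' ok [-> ->]]].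
    by exists ov => //; rewrite inE.
  by rewrite inE in ok.
apply: eq_bigr => mu _; rewrite card_overlinings prod_part_term.
case: forallP => _ /=; last by rewrite coef0.
rewrite -natrX mulr_natl coefMn coefXn eq_sym.
by case: eqP => _; rewrite ?mul0rn.
Qed.

Lemma even_parts_poly_comp : exists q, even_parts_poly = q \Po 'X^2.
Proof.
rewrite /even_parts_poly; apply: (big_ind (fun e => exists q, e = q \Po 'X^2)).
- by exists 1; rewrite rmorph1.
- by move=> _ _ [q ->] [r ->]; exists (q * r); rewrite comp_polyM.
- move=> i /even_halfK; move: i.+1./2 => h; rewrite -mul2n => <-.
  exists (1 + 2 * \sum_(j < n) 'X^(j.+1 * h)).
  rewrite !(rmorphD, rmorphM, rmorph1, rmorph_nat, rmorph_sum) /=.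
  congr (_ + _ * _); apply: eq_bigr => j _.
  by rewrite rmorphXn /= comp_polyX -exprM mulnCA.
Qed.

Lemma even_parts_poly_1D2 : exists e, even_parts_poly = 1 + 2 * e.
Proof.
have [z ez] := prod_1D2_linear (fun i : 'I_n => ~~ odd i.+1)
  (fun i : 'I_n => multiples_poly i.+1).
by eexists; rewrite /even_parts_poly ez -addrA -[4]/(2 * 2)%:R natrM -mulrA -mulrDr.
Qed.

(** * Divisibility at odd nonsquare [n] *)

Hypothesis n_odd : odd n.
Hypothesis n_nsq : forall d, (d * d)%N != n.

Lemma odd_parts_poly_1D2 :
  exists x c, odd_parts_poly = 1 + 2 * x /\ x`_n = 2 * c.
Proof.
have [z ez] := prod_1D2_linear (fun i : 'I_n => odd i.+1)
  (fun i : 'I_n => multiples_poly i.+1).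
set g := \sum_(i < n | odd i.+1) multiples_poly i.+1 in ez.
have [/= c ec] : exists c, g`_n = 2 * c.
  (* Summing over all [i], not only odd [i.+1], makes the count of factorizations of [n] symmetric;
     the extra terms vanish as [n] is odd. A diagonal term would make [n] a square. *)
  have /dvdnP [c ec] : (2 %| \sum_(i < n) \sum_(j < n) (j.+1 * i.+1 == n))%N.
    apply: sum_sym_even => [i j|i]; first by rewrite mulnC.
    by rewrite (negbTE (n_nsq _)).
  exists c%:R; rewrite mulrC -natrM -ec natr_sum coef_sum big_mkcond.
  apply: eq_bigr => i _; rewrite natr_sum coef_sum.
  case: ifP => i_odd.
    by apply: eq_bigr => j _; rewrite coefXn eq_sym.
  rewrite big1 // => j _; case: eqP => // eq_n.
  by move: n_odd; rewrite -eq_n oddM i_odd andbF.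
exists (g + 2 * z), (c + z`_n); split.
  by rewrite /odd_parts_poly ez; ring.
by rewrite coefD ec [2 * z]mulr_natl coefMn mulrDr [2 * z`_n]mulr_natl.
Qed.

(** At the odd exponent [n] the even parts alone contribute nothing, and the even coefficient of [y]
    supplies the last factor 2. *)
Lemma dvdn_abar (s k : nat) (y w : {poly int}) (c : int) :
    even_parts_poly * odd_parts_poly ^+ s.+1 =
      even_parts_poly + 2 ^+ k * y + 2 ^+ k.+1 * w ->
    y`_n = 2 * c ->
  (2 ^ k.+1 %| abar s.+1 n)%N.
Proof.
move=> ew ec; have [q eq] := even_parts_poly_comp.
have : (abar s.+1 n)%:R = (2 ^ k.+1)%:R * (c + w`_n) :> int.
  rewrite abar_coef ew !coefD !coef_pow2M ec eq coef_odd_comp_X2 // add0r.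
  by rewrite natrX mulrDr mulrA -exprSr.
move: (abar _ _) (2 ^ _)%N (_ + _) => N d t eN.
by have /dvdzP : exists t, N%:Z = t * d%:Z by exists t; rewrite mulrC -!natz.
Qed.

Lemma dvdn_abar_mod4 (s : nat) : (2 ^ 2 %| abar s.+1 n)%N.
Proof.
have [x [c [ex ec]]] := odd_parts_poly_1D2.
have [e ee] := even_parts_poly_1D2.
have [w ew] := mod4_expansion e x s.+1.
apply: (@dvdn_abar _ _ (s.+1%:R * x) w (s.+1%:R * c)).
  by rewrite ex ee ew.
by rewrite [s.+1%:R * x]mulr_natl coefMn ec [RHS]mulrCA [RHS]mulr_natl.
Qed.

Lemma dvdn_abar_pow2 (m a : nat) : odd a -> (2 ^ m.+3 %| abar (2 ^ m.+1 * a) n)%N.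
Proof.
move=> a_odd.
have [x [c [ex ec]]] := odd_parts_poly_1D2.
have [e ee] := even_parts_poly_1D2.
have [c' ec'] := coef_odd_sqr x n_odd.
have [w] := pow2_expansion e x m a_odd.
(* Positivity lets the number of colours be written as a successor. *)
have : (0 < 2 ^ m.+1 * a)%N by rewrite muln_gt0 expn_gt0 (odd_gt0 a_odd).
case: (2 ^ m.+1 * a)%N => // s _ ew.
apply: (@dvdn_abar _ _ (x + x ^+ 2) w (c + c')); first by rewrite ex ee ew.
by rewrite coefD ec ec' mulrDr.
Qed.

End GeneratingPolynomial.

(* The arithmetic progression avoids squares *)
Local Close Scope ring_scope.

Lemma odd_logn_nonsquare (p n d : nat) : odd (logn p n) -> d * d != n.
Proof.
case: d => [|d] odd_n; apply/eqP => eq_n; move: odd_n; rewrite -eq_n.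
  by rewrite logn0.
by rewrite lognM // oddD addbb.
Qed.

Theorem theorem1p6 (p m alpha beta : nat) (p_ge5 : 5 <= p) (p_prime : prime p)
  (p_mod4 : p = 3 %[mod 4]) (m_ge1 : 1 <= m) (alpha_ge1 : 1 <= alpha)
  (beta_ge1 : 1 <= beta) (alpha_odd : ~~ (2 %| alpha)) :
  forall n k : nat, ~~ (p %| n) ->
    abar (2 ^ m * alpha) (4 * p ^ (2 * k + 1) * n + p ^ (2 * k + 2)) = 0
      %[mod 2 ^ (m + 2)] /\
    abar (2 * beta + 1) (4 * p ^ (2 * k + 1) * n + p ^ (2 * k + 2)) = 0
      %[mod 4].
Proof.
move=> n k p_n; set N := 4 * _ * _ + _.
have p_odd : odd p by apply: contraTT p_ge5 => /(prime_oddPn p_prime) ->.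
have N_odd : odd N by rewrite oddD oddX p_odd orbT !oddM.
have eN : N = p ^ (2 * k + 1) * (4 * n + p).
  by rewrite mulnDr -expnSr -addnS mulnA (mulnC _ 4).
have p_cofactor : ~~ (p %| 4 * n + p).
  rewrite dvdn_addl ?dvdnn // Euclid_dvdM // (negbTE p_n) orbF.
  (* A prime dividing 4 would be at most 4. *)
  by apply: contraL p_ge5 => /dvdn_leq -/(_ isT); rewrite -ltnNge.
have N_nsq d : d * d != N.
  apply: (@odd_logn_nonsquare p).
  have p_gt0 := prime_gt0 p_prime.
  (* The cofactor [4 * n + p] is prime to [p], so the valuation is exactly [2 * k + 1]. *)
  rewrite eN lognM ?expn_gt0 ?addn_gt0 ?p_gt0 ?orbT // pfactorK //.
  by rewrite logn_coprime ?prime_coprime // addn0 oddD oddM.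
split; apply/eqP; rewrite mod0n -/(_ %| _).
  rewrite -(prednK m_ge1) addn2; apply: dvdn_abar_pow2 => //.
  by rewrite dvdn2 negbK in alpha_odd.
by rewrite addn1; apply: dvdn_abar_mod4.
Qed.
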